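(* Let $\Psi=\{\alpha;\beta^1,\dots,\beta^r\}\subset L_1(\mathbb{R})$ ($r\ge 1$) be associated with a filter bank $\{a;b_1,\dots,b_r\}\subset l_1(\mathbb{Z})$, i.e. $\widehat{\alpha}(2\xi)=\widehat{a}(\xi)\widehat{\alpha}(\xi)$ and $\widehat{\beta^n}(2\xi)=\widehat{b_n}(\xi)\widehat{\alpha}(\xi)$ for all $\xi\in\mathbb{R}$, $n=1,\dots,r$. Suppose that, on the half-line $[0,\infty)$, the supports of $\widehat{\alpha}$ and of $\widehat{\beta^n}$, $n=1,\dots,r$, are subsets of $[0,1/2]$. Let $Q_{N_j}$, $j\in\mathbb{N}_0$, be a sequence of quadrature rules on the simplex $T^2$, and let $\boldsymbol{\varphi}_{j,k}$, $\boldsymbol{\psi}^n_{j,k'}$ be the associated semi-discrete framelets. For $f\in L_2(T^2)$ let $\mathrm{v}_j$ and $\mathrm{w}^n_j$ be the sequences of framelet coefficients $$(\mathrm{v}_j)_k=\langle f,\boldsymbol{\varphi}_{j,k}\rangle,\ k=1,\dots,N_j,\qquad (\mathrm{w}^n_j)_{k'}=\langle f,\boldsymbol{\psi}^n_{j,k'}\rangle,\ k'=1,\dots,N_{j+1}.$$ Then for every $j\ge 1$, $$\mathrm{v}_{j-1}=(\mathrm{v}_j\ast_j a^\star)\downarrow_j,\qquad \mathrm{w}^n_{j-1}=\mathrm{v}_j\ast_j b_n^\star,\quad n=1,\dots,r.$$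
   Context: $\mathbb{N}_0=\{0,1,2,\dots\}$. **Simplex and basis.** $T^2=\{(x_1,x_2): x_1\ge 0,\ x_2\ge 0,\ x_1+x_2\le 1\}$, and $\mu$ is Lebesgue area measure normalized so that $\mu(T^2)=1$. $L_2(T^2)$ is the space of complex-valued square-integrable functions with inner product $\langle f,g\rangle=\int_{T^2} f\,\overline{g}\,d\mu$. For $\ell\in\mathbb{N}_0$, $\mathcal{V}_\ell$ is the $(\ell+1)$-dimensional space of polynomials of degree $\ell$ on $T^2$ that are orthogonal in $L_2(T^2)$ to all polynomials of lower degree (together with $0$). Fix an orthonormal basis $\{P_{\ell,m}: m=0,\dots,\ell\}$ of each $\mathcal{V}_\ell$; then $\{P_{\ell,m}: 0\le m\le \ell,\ \ell\ge 0\}$ is an orthonormal basis of $L_2(T^2)$. Put $\lambda_\ell=\sqrt{\ell(\ell+2)}$ and $\widehat{f}_{\ell,m}=\langle f,P_{\ell,m}\rangle$. Below, $\sum_{\ell,m}$ means $\sum_{\ell=0}^\infty\sum_{m=0}^{\ell}$. **Fourier conventions.** For $g\in L_1(\mathbb{R})$, $\widehat{g}(\xi)=\int_{\mathbb{R}} g(x)e^{-2\pi i x\xi}\,dx$. For $h=(h_k)_{k\in\mathbb{Z}}\in l_1(\mathbb{Z})$ (a mask), $\widehat{h}(\xi)=\sum_{k\in\mathbb{Z}}h_k e^{-2\pi i k\xi}$. $h^\star$ denotes the mask whose Fourier series is the complex conjugate of that of $h$: $\widehat{h^\star}=\overline{\widehat{h}}$. **Quadrature rules and framelets.** $Q_{N_j}=\{(\omega_{j,k},\boldsymbol{x}_{j,k})\}_{k=1}^{N_j}$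 consists of weights $\omega_{j,k}>0$ and points $\boldsymbol{x}_{j,k}\in T^2$ (no polynomial exactness is assumed). The semi-discrete framelets are $$\boldsymbol{\varphi}_{j,k}(\boldsymbol{x})=\sqrt{\omega_{j,k}}\sum_{\ell,m}\widehat{\alpha}\Big(\frac{\lambda_\ell}{2^j}\Big)\overline{P_{\ell,m}(\boldsymbol{x}_{j,k})}P_{\ell,m}(\boldsymbol{x}),\quad k=1,\dots,N_j,$$ $$\boldsymbol{\psi}^n_{j,k'}(\boldsymbol{x})=\sqrt{\omega_{j+1,k'}}\sum_{\ell,m}\widehat{\beta^n}\Big(\frac{\lambda_\ell}{2^j}\Big)\overline{P_{\ell,m}(\boldsymbol{x}_{j+1,k'})}P_{\ell,m}(\boldsymbol{x}),\quad k'=1,\dots,N_{j+1},\ n=1,\dots,r.$$ **Sequences and their Fourier coefficients.** $l(Q_{N_j})$ is the set of sequences $\mathrm{v}=(\mathrm{v}_k)_{k=1}^{N_j}$ of the form $(\mathrm{v})_k=\sqrt{\omega_{j,k}}\sum_{\ell,m}\mathrm{u}_{\ell,m}P_{\ell,m}(\boldsymbol{x}_{j,k})$ with $\mathrm{u}$ absolutely summable. Each such $\mathrm{v}$ is regarded as carrying the representing sequence $\mathrm{u}$, and one writes $\widehat{\mathrm{v}}_{\ell,m}:=\mathrm{u}_{\ell,m}$ (the generalized Fourier coefficients of $\mathrm{v}$). The sequence $\mathrm{v}_j$ of low-pass framelet coefficients of $f$ is regarded as an element of $l(Q_{N_j})$ with $\widehat{(\mathrm{v}_j)}_{\ell,m}=\widehat{f}_{\ell,m}\,\overline{\widehat{\alpha}(\lambda_\ell/2^j)}$.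 **Convolution.** For $\mathrm{v}\in l(Q_{N_j})$ and a mask $h$, $\mathrm{v}\ast_j h\in l(Q_{N_j})$ is $$(\mathrm{v}\ast_j h)_k=\sum_{\ell,m}\widehat{\mathrm{v}}_{\ell,m}\,\widehat{h}\Big(\frac{\lambda_\ell}{2^j}\Big)\sqrt{\omega_{j,k}}\,P_{\ell,m}(\boldsymbol{x}_{j,k}),\quad k=1,\dots,N_j,$$ with Fourier coefficients $\widehat{\mathrm{v}}_{\ell,m}\widehat{h}(\lambda_\ell/2^j)$. **Downsampling.** For $j\ge1$ and $\mathrm{v}\in l(Q_{N_j})$, $\mathrm{v}\downarrow_j\in l(Q_{N_{j-1}})$ is $$(\mathrm{v}\downarrow_j)_k=\sum_{\ell:\,\lambda_\ell\le 2^{j-1}}\sum_{m=0}^{\ell}\widehat{\mathrm{v}}_{\ell,m}\sqrt{\omega_{j-1,k}}\,P_{\ell,m}(\boldsymbol{x}_{j-1,k}),\quad k=1,\dots,N_{j-1}.$$ *)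

(* Defs.v *)
From HB Require Import structures.
From mathcomp Require Import all_boot all_order all_algebra.
From mathcomp Require Import all_classical all_reals all_analysis.
From mathcomp Require Import complex.
From mathcomp Require mpoly.
From mathcomp Require Import zify lra.
Import (coercions, canonicals) mpoly.

Set Implicit Arguments.
Unset Strict Implicit.
Unset Printing Implicit Defensive.
Import Order.TTheory GRing.Theory Num.Theory numFieldNormedType.Exports.

Local Open Scope classical_set_scope.
Local Open Scope ring_scope.
Local Open Scope complex_scope.

Section ComplexAnalysis.
Variable R : realType.

Definition cexpi (t : R) : R[i] := cos t +i* sin t.

Definition csum (u : nat -> R[i]) : R[i] := limn (series (u : nat -> R[i]^o)).

Definition cintegral d (T : measurableType d) (mu : {measure set T -> \bar R})
    (D : set T) (g : T -> R[i]) : R[i] :=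
  (\int[mu]_(x in D) complex.Re (g x)) +i* (\int[mu]_(x in D) complex.Im (g x)).

Definition cmeasurable d (T : measurableType d) (D : set T) (g : T -> R[i]) :=
  measurable_fun D (fun x => complex.Re (g x)) /\
  measurable_fun D (fun x => complex.Im (g x)).

Definition in_Lp d (T : measurableType d) (mu : {measure set T -> \bar R})
    (p : nat) (D : set T) (g : T -> R[i]) :=
  cmeasurable D g /\
  (\int[mu]_(x in D) ((Normc.normc (g x) ^+ p)%:E) < +oo)%E.

Definition in_L1 (g : R -> R[i]) := in_Lp (@lebesgue_measure R) 1 setT g.

Definition fourier (g : R -> R[i]) (xi : R) : R[i] :=
  cintegral (@lebesgue_measure R) setT
    (fun x => g x * cexpi (- (2 * pi * x * xi))).

Definition is_mask (h : int -> R[i]) :=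
  summable [set: int] (fun k => (Normc.normc (h k))%:E).

(* For an absolutely summable h, the sum over all integers is the limit of the
   partial sums over -n <= k <= n. *)
Definition fourier_series (h : int -> R[i]) (xi : R) : R[i] :=
  limn ((fun n : nat => \sum_(i < n.*2.+1)
     let k := (i%:Z - n%:Z)%R in
     h k * cexpi (- (2 * pi * k%:~R * xi))) : nat -> R[i]^o).

Definition is_mask_star (h hs : int -> R[i]) :=
  is_mask hs /\ forall xi, fourier_series hs xi = (fourier_series h xi)^*.

Lemma clim_conj (u : nat -> R[i]^o) :
  limn ((fun n => (u n)^*) : nat -> R[i]^o) = (limn u)^*.
Proof.
have cj (v : nat -> R[i]^o) (l : R[i]^o) : v @ \oo --> l ->
    ((fun n => (v n)^*) : nat -> R[i]^o) @ \oo --> (l^* : R[i]^o).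
  move=> vl.
  apply/cvgrPdist_lt => e e0. move/cvgrPdist_lt : vl => /(_ _ e0).
  apply: filterS => n; rewrite -(norm_conjC (l - v n)). by rewrite rmorphB.
have [cu|ncu] := pselect (cvgn u).
  apply: (@cvg_lim R[i]^o); first exact: norm_hausdorff.
  exact: cj.
rewrite (dvgP ncu) dvgP; last first.
  move=> c. apply: ncu. apply/cvg_ex. exists ((limn ((fun n => (u n)^*) : nat -> R[i]^o))^*).
  have := cj _ _ c; rewrite /=. under eq_fun do rewrite conjcK. by [].
by apply/eqP; rewrite eq_complex /= oppr0 !eqxx.
Qed.

Lemma mask_star_exists (h : int -> R[i]) :
  is_mask h -> exists hs, is_mask_star h hs.
Proof.
move=> mh; exists (fun k => (h (- k))^*); split.
  move: mh; rewrite /is_mask /summable => mh.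
  rewrite (@reindex_esum R int int setT setT (fun k => - k)); last first.
    split; [by []|by move=> x y _ _ /oppr_inj|by move=> y _; exists (- y) => //; exact: opprK].
  rewrite (eq_esum (b := fun k => `|(Normc.normc (h k))%:E|%E)) // => k _.
  by rewrite opprK; case: (h k) => x y /=; rewrite sqrrN.
move=> xi; rewrite /fourier_series -clim_conj; apply: (congr1 (fun u : nat -> R[i]^o => limn u)); apply/funext => n.
rewrite rmorph_sum /= (reindex_inj rev_ord_inj) /=; apply: eq_bigr => i _.
have -> : ((n.*2.+1 - i.+1)%N%:Z - n%:Z = - (i%:Z - n%:Z))%R.
  move: (nat_of_ord i) (ltn_ord i) => k hk; lia.
rewrite opprK rmorphM; congr (_ * _).
by rewrite /cexpi /= rmorphN /= mulrN mulNr cosN !sinN opprK.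
Qed.

(* The support, relative to the half-line [0, +oo[, lies in [0, 1/2]. *)
Definition half_supported (g : R -> R[i]) :=
  closure [set xi | 0 <= xi /\ g xi != 0] `<=` `[0, 2^-1].

End ComplexAnalysis.

Section Simplex.
Variable R : realType.

Definition simplex : set (R * R) :=
  [set x | [/\ 0 <= x.1, 0 <= x.2 & x.1 + x.2 <= 1]].

(* The triangle has area 1/2, hence the factor 2. *)
Definition simplex_measure :
    {measure set (measurableTypeR R * measurableTypeR R) -> \bar R} :=
  mscale (2%:nng : {nonneg R}) (@lebesgue_measure R \x @lebesgue_measure R)%E.

Lemma simplex_measure1 : simplex_measure simplex = 1%E.
Proof.
rewrite /simplex_measure /= /mscale /= /product_measure1 /=.
have -> : (\int[@lebesgue_measure R]_x ((@lebesgue_measure R) \o xsection simplex) x = \int[@lebesgue_measure R]_(x in `[0%R, 1%R]) (1 - x)%:E)%E.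
  rewrite [RHS]integral_mkcond; apply: eq_integral => x _ /=.
  rewrite patchE; case: ifPn => [|xn].
    rewrite inE /= in_itv /= => /andP[x0 x1].
    have -> : xsection simplex x = `[0, 1 - x]%classic.
      apply/seteqP; split => y /=; rewrite /xsection /= in_itv /= ?inE /simplex /=.
        by move=> [_ y0 xy]; rewrite y0 lerBrDl.
      by move=> /andP[y0 xy]; split => //; rewrite -lerBrDl.
    by rewrite lebesgue_measure_itv /= lte_fin; case: ltP => //; rewrite ?subr0 // => H; congr EFin; lra.
  rewrite (_ : xsection _ _ = set0) ?measure0 //.
  apply/seteqP; split => y //=; rewrite /xsection /= inE /simplex /= => -[x0 y0 xy].
  by move: xn; rewrite notin_setE /= in_itv /= x0 /=; apply; lra.
have -> : (\int[@lebesgue_measure R]_(x in `[0%R, 1%R]) (1 - x)%:E = (2^-1)%:E)%E.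
  have dF (x : R) : is_derive x 1 (fun x : R => x - 2^-1 * x ^+ 2) (1 - x).
    by apply: is_derive_eq; rewrite /GRing.scale /=; lra.
  have cF : continuous (fun x : R => x - 2^-1 * x ^+ 2).
    by move=> x; apply: differentiable_continuous; apply/derivable1_diffP; apply: ex_derive.
  rewrite (@continuous_FTC2 R (fun x => 1 - x) (fun x => x - 2^-1 * x ^+ 2) 0 1) //.
  - by rewrite -EFinB; congr EFin; lra.
  - apply: continuous_subspaceT => x; apply: cvgB; [exact: cvg_cst|exact: cvg_id].
  - split => [x _||].
    + by apply: ex_derive.
    + exact: cvg_at_right_filter (cF _).
    + exact: cvg_at_left_filter (cF _).
  - by move=> x _; rewrite derive1E; apply: derive_val.
by rewrite -EFinM divff.
Qed.

Definition inner (f g : R * R -> R[i]) : R[i] :=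
  cintegral simplex_measure simplex (fun x => f x * (g x)^*).

Definition in_L2 (f : R * R -> R[i]) := in_Lp simplex_measure 2 simplex f.

Definition poly2 := mpoly.mpoly 2 R[i].

Definition peval (p : poly2) (x : R * R) : R[i] :=
  mpoly.meval (fun i : 'I_2 => if i == ord0 then x.1%:C else x.2%:C) p.

(* [mpoly.msize] is the total degree plus one, and 0 for the zero polynomial. *)
Definition ortho_space (l : nat) : set poly2 :=
  [set p | p = 0 \/
    mpoly.msize p = l.+1 /\
    forall q : poly2, (mpoly.msize q <= l)%N -> inner (peval p) (peval q) = 0].

Definition orthonormal_bases (P : forall l, 'I_l.+1 -> poly2) :=
  forall l,
    [/\ forall m, ortho_space l (P l m),
        forall m m', inner (peval (P l m)) (peval (P l m')) = (m == m')%:R &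
        forall p, ortho_space l p ->
          exists c : 'I_l.+1 -> R[i], p = \sum_(m < l.+1) c m *: P l m].

Definition lambda (l : nat) : R := Num.sqrt ((l * (l + 2))%:R).

Record quadrature := Quadrature {
  qsize : nat;
  qweight : 'I_qsize -> R;
  qpoint : 'I_qsize -> R * R;
  _ : forall k, 0 < qweight k;
  _ : forall k, simplex (qpoint k) }.

Definition qsqrt (Q : quadrature) (k : 'I_(qsize Q)) : R[i] :=
  (Num.sqrt (qweight k))%:C.

(* A sequence of length N carrying generalized Fourier coefficients. *)
Record gseq (N : nat) := GSeq {
  gval : 'I_N -> R[i];
  gcoef : forall l, 'I_l.+1 -> R[i] }.

Variable P : forall l, 'I_l.+1 -> poly2.

Definition in_lQ (Q : quadrature) (v : gseq (qsize Q)) :=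
  (\sum_(l <oo) \sum_(m < l.+1) (Normc.normc (gcoef v m))%:E < +oo)%E /\
  forall k, gval v k =
    qsqrt k * csum (fun l => \sum_(m < l.+1)
      gcoef v m * peval (P m) (qpoint k)).

(* With (g, Q) = (alpha, Q_j), resp. (beta^n, Q_{j+1}), this is phi_{j,k},
   resp. psi^n_{j,k}. *)
Definition framelet (g : R -> R[i]) (j : nat) (Q : quadrature)
    (k : 'I_(qsize Q)) (x : R * R) : R[i] :=
  qsqrt k * csum (fun l => \sum_(m < l.+1)
    fourier g (lambda l / 2 ^+ j) * (peval (P m) (qpoint k))^*
      * peval (P m) x).

Definition gconv (Q : quadrature) (j : nat) (v : gseq (qsize Q))
    (h : int -> R[i]) : gseq (qsize Q) :=
  GSeq
    (fun k => csum (fun l => \sum_(m < l.+1)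
       gcoef v m * fourier_series h (lambda l / 2 ^+ j)
         * qsqrt k * peval (P m) (qpoint k)))
    (fun l (m : 'I_l.+1) =>
       gcoef v m * fourier_series h (lambda l / 2 ^+ j)).

(* Downsampling from level j.+1 to level j. *)
Definition downsample (Q : nat -> quadrature) (j : nat)
    (v : gseq (qsize (Q j.+1))) : gseq (qsize (Q j)) :=
  GSeq
    (fun k => csum (fun l => if lambda l <= 2 ^+ j then \sum_(m < l.+1)
       gcoef v m * qsqrt k * peval (P m) (qpoint k) else 0))
    (fun l (m : 'I_l.+1) => if lambda l <= 2 ^+ j then gcoef v m else 0).

Definition vseq (alpha : R -> R[i]) (f : R * R -> R[i])
    (Q : nat -> quadrature) (j : nat) : gseq (qsize (Q j)) :=
  GSeq
    (fun k => inner f (framelet alpha j k))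
    (fun l (m : 'I_l.+1) =>
       inner f (peval (P m)) * (fourier alpha (lambda l / 2 ^+ j))^*).

Definition wseq (beta : R -> R[i]) (f : R * R -> R[i])
    (Q : nat -> quadrature) (j : nat) : 'I_(qsize (Q j.+1)) -> R[i] :=
  fun k => inner f (framelet beta j k).

End Simplex.

Arguments wseq [R] P beta f Q j _.

(* Main.v *)
Require Import Defs.
From mathcomp Require Import all_boot all_order all_algebra.
From mathcomp Require Import all_classical all_reals all_analysis.
From mathcomp Require Import measurable_realfun complex.
From mathcomp Require mpoly.
From mathcomp Require Import ring lra.
Import (coercions, canonicals) mpoly.

(** Since the support condition kills [fourier g (lambda l / 2 ^+ j)] as soon as
    [2 ^ j <= l] (because [lambda l >= l]), every series over [l] that occurs is
    a finite sum.  In particular each framelet is a polynomial on the simplex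
    ([framelet_peval]).

    A square-integrable [f] is integrable against every polynomial, since the
    simplex has finite measure and the monomials are bounded on it.  Hence
    [inner f] is additive and conjugate-homogeneous on polynomials, and pairing
    [f] with a framelet term by term gives ([inner_framelet])
      <f, framelet_k> =
        sqrt w_k * sum_(l,m) <f, P_lm> (fourier g (lambda_l / 2^j))^* P_lm(x_k).

    The identities are then compared coefficient by coefficient: conjugating the
    refinement equation at [xi = lambda_l / 2^(j+1)] turns the coefficient at
    level [j] into the one at level [j+1] times the Fourier series of the starred
    mask ([fourier_refine_conj]).  Downsampling truncates only where the low-pass
    coefficient at level [j] is zero already, namely where
    [lambda_l / 2^j > 1 > 1/2]. *)

Set Implicit Arguments.
Unset Strict Implicit.
Unset Printing Implicit Defensive.
Import Order.TTheory GRing.Theory Num.Theory numFieldNormedType.Exports.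

Local Open Scope classical_set_scope.
Local Open Scope ring_scope.

(** * Finiteness of the spectral sums *)

Section FiniteSums.
Variable R : realType.

Lemma csum_finite (u : nat -> R[i]) (N : nat) :
  (forall l, (N <= l)%N -> u l = 0) -> csum u = \sum_(l < N) u l.
Proof.
move=> u0; apply: (@cvg_lim R[i]^o); first exact: norm_hausdorff.
apply: cvg_near_cst.
exists N => // n /= Nn.
rewrite /series /= (big_cat_nat (leq0n N) Nn) /= [X in _ + X]big_nat_cond.
rewrite [X in _ + X]big1 ?addr0 ?big_mkord//.
by move=> l /andP[/andP[Nl _] _]; rewrite u0.
Qed.

Lemma le_lambda (l : nat) : l%:R <= lambda R l.
Proof.
rewrite /lambda -[leLHS](ger0_norm (ler0n R l)) -sqrtr_sqr.
rewrite ler_wsqrtr // -natrX ler_nat.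
by rewrite expnS expn1 leq_mul2l leq_addr orbT.
Qed.

Lemma half_supported0 (g : R -> R[i]) (xi : R) :
  half_supported g -> 2^-1 < xi -> g xi = 0.
Proof.
move=> gs xi2; apply/eqP/negP => /negP gxi0.
have /gs : closure [set xi | 0 <= xi /\ g xi != 0] xi.
  apply: subset_closure; split=> //.
  by apply: le_trans (ltW xi2); rewrite invr_ge0.
by rewrite /= in_itv /= [xi <= _]leNgt xi2 andbF.
Qed.

(** The threshold [2 ^ j] suffices because [lambda l >= l], so that the argument
    is at least 1. *)
Lemma half_supported_lambda (g : R -> R[i]) (j l : nat) :
  half_supported g -> (2 ^ j <= l)%N -> g (lambda R l / 2 ^+ j) = 0.
Proof.
move=> gs jl; apply: half_supported0 gs _.
apply: (@lt_le_trans _ _ 1); first by lra.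
rewrite ler_pdivlMr ?exprn_gt0 // mul1r (le_trans _ (le_lambda l))//.
by rewrite -natrX ler_nat.
Qed.

End FiniteSums.

(** * Linearity of the complex integral *)

Section ComplexIntegral.
Variables (R : realType) (d : measure_display) (T : measurableType d).
Variables (mu : {measure set T -> \bar R}) (D : set T).
Hypothesis mD : measurable D.

Definition cintegrable (g : T -> R[i]) :=
  mu.-integrable D (EFin \o (fun x => complex.Re (g x))) /\
  mu.-integrable D (EFin \o (fun x => complex.Im (g x))).

Lemma ReM (z w : R[i]) : complex.Re (z * w) =
  complex.Re z * complex.Re w - complex.Im z * complex.Im w.
Proof. by case: z; case: w. Qed.

Lemma ImM (z w : R[i]) : complex.Im (z * w) =
  complex.Re z * complex.Im w + complex.Im z * complex.Re w.
Proof. by case: z; case: w. Qed.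

Lemma cintegrableD g h :
  cintegrable g -> cintegrable h -> cintegrable (fun x => g x + h x).
Proof.
move=> [g1 g2] [h1 h2]; split.
- apply: (eq_integrable mD _ _ _ (integrableD mD g1 h1)) => x _ /=.
  by rewrite raddfD.
- apply: (eq_integrable mD _ _ _ (integrableD mD g2 h2)) => x _ /=.
  by rewrite raddfD.
Qed.

Lemma cintegrableZ c g : cintegrable g -> cintegrable (fun x => c * g x).
Proof.
move=> [g1 g2]; split.
- have := integrableB mD (integrableZl mD (complex.Re c) g1)
                         (integrableZl mD (complex.Im c) g2).
  apply: eq_integrable => // x _ /=.
  by rewrite ReM.
- have := integrableD mD (integrableZl mD (complex.Re c) g2)
                         (integrableZl mD (complex.Im c) g1).
  apply: eq_integrable => // x _ /=.
  by rewrite ImM.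
Qed.

Lemma cintegrable_sum (I : Type) (s : seq I) (g : I -> T -> R[i]) :
  (forall i, cintegrable (g i)) -> cintegrable (fun x => \sum_(i <- s) g i x).
Proof.
move=> gi; elim: s => [|i s IH].
  by under eq_fun do rewrite big_nil; split; exact: integrable0.
by under eq_fun do rewrite big_cons; exact: cintegrableD.
Qed.

Lemma cintegralD g h : cintegrable g -> cintegrable h ->
  cintegral mu D (fun x => g x + h x) = cintegral mu D g + cintegral mu D h.
Proof.
move=> [g1 g2] [h1 h2]; rewrite /cintegral.
under [in X in (X +i* _)%C]eq_Rintegral do rewrite raddfD/=.
under [in X in (_ +i* X)%C]eq_Rintegral do rewrite raddfD/=.
by rewrite !RintegralD.
Qed.

Lemma cintegralZ c g : cintegrable g ->
  cintegral mu D (fun x => c * g x) = c * cintegral mu D g.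
Proof.
move=> [g1 g2]; rewrite /cintegral.
under [in X in (X +i* _)%C]eq_Rintegral do rewrite ReM.
under [in X in (_ +i* X)%C]eq_Rintegral do rewrite ImM.
have gZ (r : R) (h : T -> R) : mu.-integrable D (EFin \o h) ->
    mu.-integrable D (EFin \o (fun x => r * h x)).
  exact: integrableZl.
rewrite RintegralB ?RintegralD//; try exact: gZ.
by rewrite !RintegralZl//; apply/eqP; rewrite eq_complex ReM ImM/= !eqxx.
Qed.

Lemma cintegrable_mul_bounded (g : T -> R[i]) (h : T -> R) :
  cintegrable g -> measurable_fun D h -> (forall x, D x -> `|h x| <= 1) ->
  cintegrable (fun x => g x * (h x)%:C%C).
Proof.
move=> [g1 g2] mh h1.
have bh : [bounded h x | x in D].
  exists 1; split; [exact: num_real|move=> M M1 x Dx].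
  exact: le_trans (h1 x Dx) (ltW M1).
split.
- apply: (eq_integrable mD _ _ _ (integrableMl mD g1 mh bh)) => x _ /=.
  by rewrite ReM mulr0 subr0.
- apply: (eq_integrable mD _ _ _ (integrableMl mD g2 mh bh)) => x _ /=.
  by rewrite ImM mulr0 add0r.
Qed.

(** On a set of finite measure, [1 + |g|^2] is an integrable bound for both
    [|Re g|] and [|Im g|]. *)
Lemma in_L2_cintegrable g : (mu D < +oo)%E -> in_Lp mu 2 D g -> cintegrable g.
Proof.
move=> muD [[m1 m2] g2].
have normcE x :
    Normc.normc (g x) ^+ 2 = complex.Re (g x) ^+ 2 + complex.Im (g x) ^+ 2.
  by case: (g x) => u v /=; rewrite sqr_sqrtr// addr_ge0 ?sqr_ge0.
have i2 : mu.-integrable D (fun x => (1 + Normc.normc (g x) ^+ 2)%:E).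
  have h1 : mu.-integrable D (EFin \o cst (1 : R)).
    apply: measurable_bounded_integrable => //.
    by exists 1; split; [exact: num_real|move=> M M1 x _ /=; rewrite normr1 ltW].
  have h2 : mu.-integrable D (fun x => (Normc.normc (g x) ^+ 2)%:E).
    apply/integrableP; split.
      apply/measurable_EFinP; under eq_fun do rewrite normcE.
      by apply: measurable_funD; exact: measurable_funX.
    under eq_integral do rewrite gee0_abs ?lee_fin ?sqr_ge0//.
    exact: g2.
  by apply: (eq_integrable mD _ _ _ (integrableD mD h1 h2)) => x _ /=;
    rewrite EFinD.
split; apply: le_integrable i2 => //; try exact/measurable_EFinP.
- move=> x _ /=; rewrite lee_fin normcE [leRHS]ger0_norm; last by nra.
  by rewrite ler_norml; apply/andP; split; nra.
- move=> x _ /=; rewrite lee_fin normcE [leRHS]ger0_norm; last by nra.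
  by rewrite ler_norml; apply/andP; split; nra.
Qed.

End ComplexIntegral.

(** * Pairing a square-integrable function with polynomials *)

Section Inner.
Variable R : realType.
Implicit Types (f : R * R -> R[i]) (p q : poly2 R).

Lemma measurable_simplex :
  measurable (@simplex R : set (measurableTypeR R * measurableTypeR R)).
Proof.
have -> : @simplex R = fst @^-1` `[0, +oo[ `&` snd @^-1` `[0, +oo[
   `&` (fun x => x.1 + x.2) @^-1` `]-oo, 1].
  apply/seteqP; split=> x /=; rewrite !in_itv/= !andbT.
    by move=> [].
  by move=> [[]].
pose T := (measurableTypeR R * measurableTypeR R)%type.
have m1 : measurable_fun [set: T] (fst : T -> measurableTypeR R).
  exact: measurable_fst.
have m2 : measurable_fun [set: T] (snd : T -> measurableTypeR R).
  exact: measurable_snd.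
have m3 : measurable_fun [set: T]
    (fun x : T => (x.1 + x.2 : measurableTypeR R)).
  exact: measurable_funD.
by apply: measurableI; [apply: measurableI|];
  rewrite -[X in measurable X]setTI; [apply: m1|apply: m2|apply: m3] => //;
  exact: measurable_itv.
Qed.

(** Expanding the polynomial reduces the claim to monomials, which take values
    between 0 and 1 on the simplex. *)
Lemma cintegrable_inner_poly f p : in_L2 f ->
  cintegrable (@simplex_measure R) (@simplex R) (fun x => f x * (peval p x)^*).
Proof.
move=> f2.
have fi : cintegrable (@simplex_measure R) (@simplex R) f.
  apply: in_L2_cintegrable f2; first exact: measurable_simplex.
  by rewrite simplex_measure1 ltry.
pose mono (m : mpoly.multinom 2) (x : R * R) : R :=
  x.1 ^+ mpoly.fun_of_multinom m ord0 *
  x.2 ^+ mpoly.fun_of_multinom m (lift ord0 ord0).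
have -> : (fun x => f x * (peval p x)^*) =
    (fun x => \sum_(m <- mpoly.msupp p)
       (mpoly.mcoeff m p)^* * (f x * (mono m x)%:C%C)).
  apply/funext => x; rewrite /peval mpoly.mevalE rmorph_sum mulr_sumr.
  apply: eq_bigr => m _.
  rewrite rmorphM/= [RHS]mulrCA; congr (_ * (_ * _)).
  rewrite !big_ord_recl big_ord0 mulr1 /=.
  rewrite -!(rmorphXn (real_complex R)) -(rmorphM (real_complex R)) /=.
  exact: conjc_real.
apply: cintegrable_sum; first exact: measurable_simplex.
move=> m; apply: cintegrableZ; first exact: measurable_simplex.
apply: cintegrable_mul_bounded => //; first exact: measurable_simplex.
- apply: measurable_funTS; apply: measurable_funM; apply: measurable_funX.
    exact: measurable_fst.
  exact: measurable_snd.
- move=> [u v] [/= u0 v0 uv]; rewrite /mono/= normrM !normrX !ger0_norm//.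
  by rewrite mulr_ile1 ?exprn_ge0 ?exprn_ile1//; lra.
Qed.

Lemma inner_pevalD f p q : in_L2 f ->
  inner f (peval (p + q)) = inner f (peval p) + inner f (peval q).
Proof.
move=> f2; rewrite /inner -cintegralD; first last.
- exact: cintegrable_inner_poly.
- exact: cintegrable_inner_poly.
- exact: measurable_simplex.
congr (cintegral _ _ _); apply/funext => x.
by rewrite /peval mpoly.mevalD rmorphD mulrDr.
Qed.

Lemma inner_pevalZ f c p : in_L2 f ->
  inner f (peval (c *: p)) = c^* * inner f (peval p).
Proof.
move=> f2; rewrite /inner -cintegralZ; first last.
- exact: cintegrable_inner_poly.
- exact: measurable_simplex.
congr (cintegral _ _ _); apply/funext => x.
by rewrite /peval mpoly.mevalZ rmorphM mulrCA.
Qed.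

Lemma inner_peval_sum f (I : Type) (s : seq I) (p : I -> poly2 R) : in_L2 f ->
  inner f (peval (\sum_(i <- s) p i)) = \sum_(i <- s) inner f (peval (p i)).
Proof.
move=> f2; apply: (big_morph (fun p => inner f (peval p))).
  by move=> p1 p2; exact: inner_pevalD.
by rewrite -(scale0r (0 : poly2 R)) inner_pevalZ// rmorph0 mul0r.
Qed.

End Inner.

(** * Framelet coefficients *)

Section Framelets.
Variables (R : realType) (P : forall l, 'I_l.+1 -> poly2 R).
Arguments P {l}.

Definition framelet_poly (g : R -> R[i]) (j : nat) (Q : quadrature R)
    (k : 'I_(qsize Q)) : poly2 R :=
  qsqrt k *: \sum_(l < 2 ^ j) \sum_(m < l.+1)
    (fourier g (lambda R l / 2 ^+ j) * (peval (P m) (qpoint k))^*) *: P m.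

Lemma framelet_peval g j Q (k : 'I_(qsize Q)) : half_supported (fourier g) ->
  framelet (@P) g j k = peval (framelet_poly g j k).
Proof.
move=> gs; apply/funext => x; rewrite /framelet (@csum_finite _ _ (2 ^ j)).
  rewrite /framelet_poly /peval mpoly.mevalZ; congr (_ * _).
  rewrite raddf_sum; apply: eq_bigr => l _.
  rewrite raddf_sum; apply: eq_bigr => m _ /=. by rewrite mpoly.mevalZ.
by move=> l jl; rewrite big1// => m _; rewrite half_supported_lambda// !mul0r.
Qed.

Lemma conj_qsqrt (Q : quadrature R) (k : 'I_(qsize Q)) : (qsqrt k)^* = qsqrt k.
Proof. exact: conjc_real. Qed.

Lemma inner_framelet f g j Q (k : 'I_(qsize Q)) :
  in_L2 f -> half_supported (fourier g) ->
  inner f (framelet (@P) g j k) = csum (fun l => \sum_(m < l.+1)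
    inner f (peval (P m)) * (fourier g (lambda R l / 2 ^+ j))^* *
      qsqrt k * peval (P m) (qpoint k)).
Proof.
move=> f2 gs; rewrite framelet_peval// (@csum_finite _ _ (2 ^ j)); last first.
  move=> l jl; rewrite big1// => m _.
  by rewrite half_supported_lambda// rmorph0 mulr0 !mul0r.
rewrite inner_pevalZ// conj_qsqrt inner_peval_sum// mulr_sumr.
apply: eq_bigr => l _; rewrite inner_peval_sum// mulr_sumr.
apply: eq_bigr => m _; rewrite inner_pevalZ// rmorphM /= conjCK; ring.
Qed.

Lemma vseq_in_lQ f g Q j : in_L2 f -> half_supported (fourier g) ->
  in_lQ (@P) (vseq (@P) g f Q j).
Proof.
move=> f2 gs; split; last first.
  move=> k /=; rewrite inner_framelet//.
  rewrite !(@csum_finite _ _ (2 ^ j)); first last.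
  - move=> l jl; rewrite big1// => m _.
    by rewrite half_supported_lambda// rmorph0 mulr0 !mul0r.
  - move=> l jl; rewrite big1// => m _.
    by rewrite half_supported_lambda// rmorph0 mulr0 !mul0r.
  rewrite mulr_sumr; apply: eq_bigr => l _; rewrite mulr_sumr.
  by apply: eq_bigr => m _; ring.
rewrite (nneseries_split 0 (2 ^ j)); last first.
  move=> l _; apply: sume_ge0 => m _; rewrite lee_fin.
  by case: (gcoef _ _) => u v; exact: sqrtr_ge0.
rewrite eseries0 ?adde0; last first.
  move=> l jl _; rewrite big1// => m _.
  rewrite /vseq [gcoef _]/gcoef half_supported_lambda// rmorph0 mulr0.
  by rewrite /Normc.normc /= expr0n /= addr0 sqrtr0.
by under eq_bigr do rewrite sumEFin; rewrite sumEFin ltry.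
Qed.

(** The argument doubles from one level to the next, so the refinement equation
    is used at [xi = lambda l / 2 ^+ j.+1]. *)
Lemma fourier_refine_conj (g g1 : R -> R[i]) (h hs : int -> R[i]) (j l : nat) :
  (forall xi, fourier g1 (2 * xi) = fourier_series h xi * fourier g xi) ->
  is_mask_star h hs ->
  (fourier g (lambda R l / 2 ^+ j.+1))^* *
    fourier_series hs (lambda R l / 2 ^+ j.+1) =
  (fourier g1 (lambda R l / 2 ^+ j))^*.
Proof.
move=> gh [_ ->]; rewrite -rmorphM mulrC -gh; congr ((fourier _ _)^*).
by rewrite exprS invfM mulrCA mulVKf ?pnatr_eq0.
Qed.

End Framelets.

(** * Decomposition *)

Theorem proposition1 (R : realType)
    (P : forall l : nat, 'I_l.+1 -> poly2 R)
    (hP : orthonormal_bases P)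
    (r : nat) (hr : (1 <= r)%N)
    (alpha : R -> R[i]) (beta : 'I_r -> R -> R[i])
    (halpha : in_L1 alpha) (hbeta : forall n, in_L1 (beta n))
    (a : int -> R[i]) (b : 'I_r -> int -> R[i])
    (ha : is_mask a) (hb : forall n, is_mask (b n))
    (hrefine_a : forall xi : R,
       fourier alpha (2 * xi) = fourier_series a xi * fourier alpha xi)
    (hrefine_b : forall (n : 'I_r) (xi : R),
       fourier (beta n) (2 * xi) = fourier_series (b n) xi * fourier alpha xi)
    (hsupp_a : half_supported (fourier alpha))
    (hsupp_b : forall n, half_supported (fourier (beta n)))
    (a_star : int -> R[i]) (b_star : 'I_r -> int -> R[i])
    (ha_star : is_mask_star a a_star)
    (hb_star : forall n, is_mask_star (b n) (b_star n))
    (Q : nat -> quadrature R)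
    (f : R * R -> R[i]) (hf : in_L2 f) :
  (forall j : nat, in_lQ P (vseq P alpha f Q j)) /\
  (forall j : nat,
     vseq P alpha f Q j =
       downsample P (gconv P j.+1 (vseq P alpha f Q j.+1) a_star) /\
     forall n : 'I_r,
       wseq P (beta n) f Q j =
         gval (gconv P j.+1 (vseq P alpha f Q j.+1) (b_star n))).
Proof.
split=> j; first exact: vseq_in_lQ.
split=> [|n]; last first.
  apply/funext => k; rewrite /wseq inner_framelet//=; congr csum.
  apply/funext => l; apply: eq_bigr => m _.
  by rewrite -(fourier_refine_conj _ _ (hrefine_b n) (hb_star n)) !mulrA.
(* where the truncation acts, the coefficient of [vseq] is already zero *)
have cut l : ~~ (lambda R l <= 2 ^+ j) ->
    (fourier alpha (lambda R l / 2 ^+ j))^* = 0.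
  rewrite -ltNge => jl; rewrite (half_supported0 hsupp_a) ?rmorph0//.
  by apply: (@lt_trans _ _ 1); [lra|rewrite ltr_pdivlMr ?exprn_gt0// mul1r].
rewrite /vseq /downsample /gconv /=; congr GSeq.
- apply/funext => k; rewrite inner_framelet//; congr csum.
  apply/funext => l; case: ifPn => [_|/cut al].
    apply: eq_bigr => m _.
    by rewrite -(fourier_refine_conj _ _ hrefine_a ha_star) !mulrA.
  by rewrite big1// => m _; rewrite al mulr0 !mul0r.
- apply: functional_extensionality_dep => l; apply/funext => m.
  case: ifPn => [_|/cut ->].
    by rewrite -(fourier_refine_conj _ _ hrefine_a ha_star) !mulrA.
  by rewrite mulr0.
Qed.
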